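(* (a) For each $n\ge 1$, each $0\le m\le\binom n2$ and each $t>0$, $\mathbb P\big(|q^*(G_{n,m})-\mathbb E[q^*(G_{n,m})]|\ge t\big)<2e^{-t^2m/2}$. (b) There is a constant $\eta>0$ such that for each $n\ge 1$ and each $0<p<1$, with $\mu=\binom n2 p$, for each $t\ge 0$, $\mathbb P\big(|q^*(G_{n,p})-\mathbb E[q^*(G_{n,p})]|\ge t\big)<2e^{-\eta\mu t^2}$.
   Context: For a graph $G$ with $m\ge 1$ edges and a vertex partition $\mathcal A$, $q_{\mathcal A}(G)=\frac1m\sum_{A\in\mathcal A}e(A)-\frac{1}{4m^2}\sum_{A\in\mathcal A}\mathrm{vol}(A)^2$ ($e(A)$: number of edges within $A$; $\mathrm{vol}(A)$: sum of degrees in $A$); $q^*(G)=\max_{\mathcal A}q_{\mathcal A}(G)$, with $q^*(G)=0$ if $G$ has no edges. $G_{n,p}$ is the Erdős–Rényi random graph on $[n]$ with independent edge probability $p$; $G_{n,m}$ is uniformly random among graphs on $[n]$ with exactly $m$ edges. *)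

(* Defs.v *)
From HB Require Import structures.
From mathcomp Require Import all_boot all_order all_algebra.

Set Implicit Arguments.
Unset Strict Implicit.
Unset Printing Implicit Defensive.

Import Order.TTheory GRing.Theory Num.Theory.
Local Open Scope ring_scope.

(* Simple graphs on the vertex set V: an edge is a 2-element set of vertices. *)
Record graph (V : finType) := Graph {
  edges : {set {set V}};
  edges_card2 : [forall e in edges, #|e| == 2%N] }.

HB.instance Definition _ (V : finType) := [isSub for @edges V].
HB.instance Definition _ (V : finType) := [Finite of graph V by <:].

Section Modularity.
Variables (R : realFieldType) (V : finType) (G : graph V).

Definition degree (v : V) : nat := #|[set e in edges G | v \in e]|.
Definition vol (A : {set V}) : nat := (\sum_(v in A) degree v)%N.
Definition edges_within (A : {set V}) : nat := #|[set e in edges G | e \subset A]|.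

Definition modularity (P : {set {set V}}) : R :=
  let m := #|edges G|%:R in
  m^-1 * (\sum_(A in P) (edges_within A)%:R)
  - (4 * m ^+ 2)^-1 * (\sum_(A in P) (vol A)%:R ^+ 2).

(* The starting value of the iterated maximum is the score of the one-block *)
(* partition, which is a partition as soon as V is nonempty. *)
Definition max_modularity : R :=
  if edges G == set0 then 0
  else \big[Num.max/modularity [set [set: V]]]_(P : {set {set V}} |
         partition P [set: V]) modularity P.

Lemma max_modularity_is_max : edges G != set0 ->
  (exists2 P, partition P [set: V] & max_modularity = modularity P) /\
  (forall P, partition P [set: V] -> modularity P <= max_modularity).
Proof.
move=> G0; rewrite /max_modularity (negPf G0); split; last first.
  by move=> P hP; exact: le_bigmax_cond.
elim/big_ind: _ => [|x y [P hP ->] [Q hQ ->]|P hP]; last by exists P.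
- exists [set [set: V]] => //.
  have [e eG] := set0Pn _ G0.
  have /forall_inP/(_ _ eG)/eqP e2 := edges_card2 G.
  have /card_gt0P[v _] : (0 < #|e|)%N by rewrite e2.
  rewrite /partition /cover big_set1 eqxx trivIset1 /= inE eq_sym.
  by apply/set0Pn; exists v; rewrite inE.
- by case: leP => _; [exists Q | exists P].
Qed.

End Modularity.

(* Probability on a finite type with probability mass function f. *)
Section FiniteProbability.
Variables (R : realFieldType) (T : finType) (f : T -> R).

Definition is_pmf : Prop := (forall x, 0 <= f x) /\ \sum_x f x = 1.
Definition Pr (A : pred T) : R := \sum_(x | A x) f x.
Definition Ex (X : T -> R) : R := \sum_x f x * X x.

End FiniteProbability.

Definition Gnm (R : realFieldType) (n m : nat) (G : graph 'I_n) : R :=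
  if #|edges G| == m then #|[set H : graph 'I_n | #|edges H| == m]|%:R^-1
  else 0.

Definition Gnp (R : realFieldType) (n : nat) (p : R) (G : graph 'I_n) : R :=
  \prod_(e : {set 'I_n} | #|e| == 2%N) (if e \in edges G then p else 1 - p).

Lemma Gnm_pmf (R : realFieldType) (n m : nat) :
  (m <= 'C(n, 2))%N -> is_pmf (@Gnm R n m).
Proof.
move=> mn; split=> [G|]; first by rewrite /Gnm; case: ifP => // _; rewrite invr_ge0 ler0n.
rewrite /Gnm -big_mkcond /= sumr_const -cardsE -[LHS]mulr_natl divff //.
rewrite pnatr_eq0 -lt0n.
pose K := [set e : {set 'I_n} | #|e| == 2%N].
have cK : #|K| = 'C(n, 2) by rewrite card_draws card_ord.
have : (0 < #|[set E : {set {set 'I_n}} | E \subset K & #|E| == m]|)%N.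
  by rewrite cards_draws cK bin_gt0.
case/card_gt0P => E; rewrite inE => /andP[/subsetP EK Em].
have hE : [forall e in E, #|e| == 2%N].
  by apply/forall_inP => e /EK; rewrite inE.
by apply/card_gt0P; exists (Graph hE); rewrite inE.
Qed.

Lemma Gnp_pmf (R : realFieldType) (n : nat) (p : R) :
  0 <= p <= 1 -> is_pmf (@Gnp R n p).
Proof.
move=> /andP[p0 p1]; split=> [G|].
  by apply: prodr_ge0 => e _; case: ifP => // _; rewrite subr_ge0.
pose K := [set e : {set 'I_n} | #|e| == 2%N].
pose w (e : {set 'I_n}) : R := if e \in K then p else 0.
pose w' (e : {set 'I_n}) : R := if e \in K then 1 - p else 1.
transitivity (\prod_e (w e + w' e)); last first.
  by apply: big1 => e _; rewrite /w /w'; case: ifP => _; rewrite ?add0r // addrC subrK.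
rewrite bigA_distr; under [RHS]eq_bigl do rewrite inE.
rewrite [RHS](bigID (fun E : {set {set 'I_n}} => [forall e in E, #|e| == 2%N])) /=.
rewrite [X in _ = _ + X]big1 ?addr0 => [|E]; last first.
  case/forall_inPn => e eE ne2.
  by rewrite (bigD1 e) //= eE /w inE (negPf ne2) mul0r.
have h0 : [forall e in set0, #|e : {set 'I_n}| == 2%N].
  by apply/forall_inP => e; rewrite inE.
rewrite (reindex_onto (@edges 'I_n) (insubd (Graph h0))) /=; last first.
  by move=> E hE; rewrite [LHS]insubdK.
apply: eq_big => [G|G _].
  by rewrite edges_card2 /= (valKd (Graph h0) G) eqxx.
rewrite /Gnp big_mkcond; apply: eq_bigr => e _; rewrite /w /w' inE.
case: ifPn => // ne2; case: ifP => // eG.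
by have /forall_inP/(_ _ eG) := edges_card2 G; rewrite (negPf ne2).
Qed.

(* Main.v *)
Require Import Defs.
From mathcomp Require Import all_boot all_order all_algebra.
From mathcomp Require Import ring lra.
From mathcomp Require Import topology normedtype derive realfun.
From mathcomp Require Import reals sequences exp.
Import Order.TTheory GRing.Theory Num.Theory.
Import numFieldNormedType.Exports.
Set Implicit Arguments.
Unset Strict Implicit.
Unset Printing Implicit Defensive.
Local Open Scope ring_scope.

(** Writing [max_score E] for the modularity of the graph with edge set [E],
   swapping one edge moves it by at most [2 / m], and adding one edge moves
   [#|E| * max_score E] by at most [2].

   (a) A uniform [m]-subset is revealed one edge at a time: averaging over the
   last edge preserves the swap-Lipschitz property, so Hoeffding's lemma can be
   applied [m] times, and the moment generating function bound
   [exp (m s^2 c^2 / 8)] with [c = 2 / m] gives the stated exponent.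

   (b) The modularity is replaced by [#|E| * max_score E / max (#|E|, mu / 2)],
   which is Lipschitz with constant [6 / mu] on all graphs and agrees with it
   unless the number of edges is below [mu / 2]. Each independent edge
   contributes variance at most [p (6 / mu)^2], so the exponential moment is
   [exp (O (s^2 / mu))] for [s = O (mu)]; the event of few edges has probability
   [exp (- Omega (mu))] by the same bound. The constant [eta] is chosen so
   small that the claim is void when [mu t^2 < 2304]; otherwise the probability
   of the exceptional event is below [t / 2]. *)

(** * Hoeffding's lemma and the Chernoff bound *)

Section Hoeffding.
Variable R : realType.
Implicit Types (p u : R).

Lemma is_derive_ge0_le (f df : R -> R) u :
  (forall x : R, is_derive x 1 f (df x)) -> (forall x, 0 <= x -> 0 <= df x) ->
  0 <= u -> f 0 <= f u.
Proof.
move=> fdf df0 u0; rewrite -subr_ge0.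
have [|x xu ->] := MVT_segment u0 (fun x _ => fdf x).
  apply: derivable_within_continuous => x _.
  by have [] := fdf x.
by rewrite subr0 mulr_ge0 // df0 //; move: xu; rewrite in_itv /= => /andP[].
Qed.

(* The logarithm of the left-hand side has second derivative
   [theta (1 - theta) <= 1 / 4], with [theta] the tilted success probability. *)
Lemma bernoulli_mgf_ge0 p u : 0 <= p <= 1 -> 0 <= u ->
  1 - p + p * expR u <= expR (p * u + u ^+ 2 / 8).
Proof.
move=> /andP[p0 p1] u0.
pose y x : R := 1 - p + p * expR x.
have y_gt0 x : 0 < y x.
  have := expR_gt0 x; rewrite /y => ex.
  have [->|p_neq0] := eqVneq p 0; first lra.
  have : 0 < p * expR x by rewrite mulr_gt0 // lt_def p_neq0.
  lra.
have y_neq0 x : y x != 0 by rewrite gt_eqF.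
have dy (x : R) : is_derive x 1 y (p * expR x).
  rewrite /y; apply: is_derive_eq; rewrite /GRing.scale /=; ring.
(* [h] is the derivative of the gap [f] introduced below, with [p * expR x] rewritten through [y x];
   it vanishes at 0. *)
pose h x : R := p + x / 4 - 1 + (1 - p) / y x.
have h_ge0 x : 0 <= x -> 0 <= h x.
  move=> x0; have -> : 0 = h 0.
    by rewrite /h /y expR0 mulr1 subrK divr1; ring.
  apply: (@is_derive_ge0_le h (fun x => 4^-1 - (1 - p) * (p * expR x) / (y x) ^+ 2)) => //.
    move=> z; rewrite /h.
    have dV := is_deriveV (y_neq0 z) (dy z).
    apply: is_derive_eq; rewrite /GRing.scale /=.
    by field; rewrite y_neq0.
  (* The inequality [4 a b <= (a + b) ^+ 2] with [a = 1 - p] and [b = p * expR z]. *)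
  move=> z _; rewrite subr_ge0 ler_pdivrMr ?exprn_gt0 // /y.
  have := sqr_ge0 (1 - p - p * expR z); lra.
have lny_le : ln (y u) <= p * u + u ^+ 2 / 8.
  pose f x : R := p * x + x ^+ 2 / 8 - ln (y x).
  suff : f 0 <= f u by rewrite /f /y expR0 mulr1 subrK ln1; lra.
  apply: (@is_derive_ge0_le f h); [move=> x|exact: h_ge0|exact: u0].
  rewrite /f.
  have dl : is_derive x 1 (fun x => ln (y x)) ((y x)^-1 * (p * expR x)).
    apply: (@is_derive1_comp _ (@ln R) y); exact: is_derive1_ln.
  apply: is_derive_eq; rewrite /GRing.scale /= /h.
  have -> : p * expR x = y x - (1 - p) by rewrite /y; ring.
  by field; rewrite y_neq0.
by rewrite -[leLHS]lnK ?posrE ?ler_expR //; apply: y_gt0.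
Qed.

(** For negative [u], factoring out [expR u] exchanges success and failure and leads back to the
    case of [- u]. *)
Lemma bernoulli_mgf p u : 0 <= p <= 1 ->
  1 - p + p * expR u <= expR (p * u + u ^+ 2 / 8).
Proof.
move=> p01; have [u0|/ltW u0] := leP 0 u; first exact: bernoulli_mgf_ge0.
have q01 : 0 <= 1 - p <= 1 by case/andP: p01; lra.
have Nu0 : 0 <= - u by rewrite oppr_ge0.
have := bernoulli_mgf_ge0 q01 Nu0; rewrite -(ler_pM2l (expR_gt0 u)) -expRD.
rewrite mulrDr mulrCA -expRD subrr expR0.
have -> : u + ((1 - p) * - u + (- u) ^+ 2 / 8) = p * u + u ^+ 2 / 8 by lra.
by apply: le_trans; lra.
Qed.

(* Convexity of [expR], from its tangents at [a * u]. *)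
Lemma expR_chord (a u : R) : 0 <= a <= 1 -> expR (a * u) <= 1 - a + a * expR u.
Proof.
move=> /andP[a0 a1].
have H1 := expR_ge1Dx (u - a * u); have H2 := expR_ge1Dx (- (a * u)).
have : 1 <= a * expR (u - a * u) + (1 - a) * expR (- (a * u)) by nra.
rewrite -(ler_pM2l (expR_gt0 (a * u))) mulr1 => /le_trans; apply.
rewrite mulrDr !(mulrCA (expR (a * u))) -!expRD subrr expR0.
rewrite addrC addrCA subrr addr0; lra.
Qed.

(** After rescaling the values to the unit interval, the chord of [expR] reduces the claim to a
    Bernoulli variable with the same mean [q]. The range is only constrained on the support, so [P]
    may be uniform on a subset. *)
Lemma hoeffding_lemma (T : finType) (P X : T -> R) (a c s : R) :
  is_pmf P -> 0 < c -> (forall x, P x != 0 -> a <= X x <= a + c) ->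
  Ex P (fun x => expR (s * X x)) <= expR (s * Ex P X + s ^+ 2 * c ^+ 2 / 8).
Proof.
move=> [P0 P1] c0 Xac.
pose th x := (X x - a) / c; pose q := \sum_x P x * th x; pose u := s * c.
have th01 x : P x != 0 -> 0 <= th x <= 1.
  by move=> /Xac /andP[? ?]; rewrite /th divr_ge0 ?ler_pdivrMr ?(ltW c0) ?subr_ge0 //=; lra.
have q01 : 0 <= q <= 1.
  apply/andP; split.
    apply: sumr_ge0 => x _; have [->|/th01 /andP[? _]] := eqVneq (P x) 0; first by rewrite mul0r.
    by rewrite mulr_ge0.
  rewrite -P1; apply: ler_sum => x _.
  have [->|/th01 /andP[_ ?]] := eqVneq (P x) 0; first by rewrite mul0r.
  by rewrite ler_piMr.
have EX : Ex P X = a + c * q.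
  rewrite /Ex /q mulr_sumr -[a]mulr1 -P1 mulr_sumr -big_split /=.
  apply: eq_bigr => x _; rewrite /th; field; exact: lt0r_neq0.
apply: (@le_trans _ _ (expR (s * a) * (1 - q + q * expR u))).
  apply: (@le_trans _ _ (\sum_x P x * (expR (s * a) * (1 - th x + th x * expR u)))).
    apply: ler_sum => x _.
    have [->|/th01 ?] := eqVneq (P x) 0; first by rewrite !mul0r.
    rewrite ler_wpM2l //.
    have -> : s * X x = s * a + th x * u by rewrite /th /u; field; exact: lt0r_neq0.
    by rewrite expRD ler_pM2l ?expR_gt0 // expR_chord.
  rewrite le_eqVlt; apply/orP; left; apply/eqP.
  transitivity (expR (s * a) * (\sum_x P x + (expR u - 1) * q)).
    rewrite /q mulr_sumr -big_split mulr_sumr; apply: eq_bigr => x _ /=; ring.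
  rewrite P1; ring.
have := bernoulli_mgf u q01; rewrite -(ler_pM2l (expR_gt0 (s * a))) => /le_trans; apply.
rewrite -expRD ler_expR EX /u; lra.
Qed.

(** Markov's inequality for both tails at once. The term [b] stays abstract because the two graph
    models yield different variance terms. *)
Lemma chernoff_two_sided (T : finType) (P X : T -> R) (b s t : R) :
  is_pmf P -> 0 <= s ->
  Ex P (fun x => expR (s * X x)) <= expR (s * Ex P X + b) ->
  Ex P (fun x => expR (- s * X x)) <= expR (- s * Ex P X + b) ->
  Pr P (fun x => t <= `|X x - Ex P X|) < 2 * expR (b - s * t).
Proof.
move=> [P0 P1] s0 Hp Hm; set m := Ex P X in Hp Hm *.
have [x0 Px0] : exists x, 0 < P x.
  apply/existsP; apply: contra_eqT P1 => /existsPn P_le0.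
  rewrite big1 => [|x _]; first by rewrite eq_sym oner_eq0.
  by apply/eqP; rewrite eq_le P0 andbT leNgt P_le0.
(* [g] dominates the indicator of the event strictly, which is where the strict
   inequality comes from. *)
pose g x := expR (- s * (m + t)) * expR (s * X x) + expR (s * (m - t)) * expR (- s * X x).
have g_gt0 x : 0 < g x by rewrite addr_gt0 // mulr_gt0 // expR_gt0.
have Hg x : t <= `|X x - m| -> 1 < g x.
  rewrite /g -!expRD => H.
  have [xm|mx] := leP m (X x).
    have : t <= X x - m by move: H; rewrite ger0_norm ?subr_ge0.
    move=> tx; apply: (@lt_le_trans _ _ (1 + expR (s * (m - t) + - s * X x))).
      by rewrite ltrDl expR_gt0.
    rewrite lerD2r -[leLHS]expR0 ler_expR; nra.
  have : t <= m - X x by move: H; rewrite ltr0_norm ?subr_lt0 // opprB.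
  move=> tx; apply: (@lt_le_trans _ _ (expR (- s * (m + t) + s * X x) + 1)).
    by rewrite ltrDr expR_gt0.
  rewrite lerD2l -[leLHS]expR0 ler_expR; nra.
apply: (@lt_le_trans _ _ (\sum_x P x * g x)).
  rewrite /Pr big_mkcond /= (bigD1 x0) //= [ltRHS](bigD1 x0) //=.
  apply: ltr_leD.
    case: ifP => [/Hg|_]; last by rewrite mulr_gt0.
    by rewrite ltr_pMr.
  apply: ler_sum => x _; case: ifP => [/Hg/ltW H|_]; last by rewrite mulr_ge0 ?P0 // ltW.
  by rewrite ler_peMr ?P0.
have -> : \sum_x P x * g x = expR (- s * (m + t)) * Ex P (fun x => expR (s * X x))
   + expR (s * (m - t)) * Ex P (fun x => expR (- s * X x)).
  rewrite /Ex !mulr_sumr -big_split; apply: eq_bigr => x _; rewrite /g /=; ring.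
apply: (@le_trans _ _ (expR (- s * (m + t)) * expR (s * m + b) +
   expR (s * (m - t)) * expR (- s * m + b))).
  by rewrite lerD // ler_pM2l ?expR_gt0.
rewrite -!expRD mulr_natl mulr2n le_eqVlt; apply/orP; left; apply/eqP.
by congr (expR _ + expR _); ring.
Qed.

End Hoeffding.

(** * Uniformly random subsets of fixed size *)

Section UniformSubset.
Variables (R : realType) (T : finType).

Lemma hoeffding_uniform (D : {set T}) (g : T -> R) (c s : R) :
  D != set0 -> 0 < c -> {in D &, forall x y, g x - g y <= c} ->
  #|D|%:R^-1 * (\sum_(x in D) expR (s * g x)) <=
  expR (s * (#|D|%:R^-1 * (\sum_(x in D) g x)) + s ^+ 2 * c ^+ 2 / 8).
Proof.
move=> /set0Pn [d dD] c0 gc.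
have D0 : (#|D|%:R : R) != 0 by rewrite pnatr_eq0 -lt0n; apply/card_gt0P; exists d.
pose P (x : T) : R := if x \in D then #|D|%:R^-1 else 0.
have PD (F : T -> R) : #|D|%:R^-1 * (\sum_(x in D) F x) = Ex P F.
  rewrite mulr_sumr big_mkcond; apply: eq_bigr => x _.
  by rewrite /P; case: ifP; rewrite ?mul0r.
have P_pmf : is_pmf P.
  split=> [x|]; first by rewrite /P; case: ifP; rewrite ?invr_ge0.
  by rewrite -big_mkcond sumr_const -[LHS]mulr_natr mulVf.
(* The minimiser of [g] turns the bound on pairwise differences into an interval of length [c]. *)
pose x0 := [arg min_(x < d in D) g x]%O.
have [x0D gx0] : x0 \in D /\ {in D, forall x, g x0 <= g x}.
  by rewrite /x0; case: arg_minP.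
rewrite !PD; apply: (@hoeffding_lemma _ _ _ _ (g x0)) => // x.
rewrite /P; case: ifP => [xD _|]; last by rewrite eqxx.
by rewrite gx0 //= -lerBlDl gc.
Qed.

Variable K : {set T}.

Definition uniform_mean (m : nat) (f : {set T} -> R) : R :=
  'C(#|K|, m)%:R^-1 * \sum_(E : {set T} | (E \subset K) && (#|E| == m)) f E.

(** The conditional expectation of [f] when only the last drawn element is still hidden: one step of
    the Doob martingale. *)
Definition mean_extension (f : {set T} -> R) (S : {set T}) : R :=
  #|K :\: S|%:R^-1 * \sum_(x in K :\: S) f (x |: S).

Definition swap_lipschitz (c : R) (m : nat) (f : {set T} -> R) :=
  forall (S : {set T}) x y, S \subset K -> (#|S|.+1 = m)%N ->
  x \in K :\: S -> y \in K :\: S -> f (x |: S) - f (y |: S) <= c.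

(** Double counting of an [m.+1]-subset with a marked element, together with the identity relating
    ['C(#|K|, m.+1)] to ['C(#|K|, m)]. *)
Lemma uniform_mean_extension m f : (m < #|K|)%N ->
  uniform_mean m (mean_extension f) = uniform_mean m.+1 f.
Proof.
move=> mK; rewrite /uniform_mean.
have -> : \sum_(E : {set T} | (E \subset K) && (#|E| == m)) mean_extension f E =
  (#|K| - m)%:R^-1 * \sum_(E : {set T} | (E \subset K) && (#|E| == m))
     \sum_(x in K :\: E) f (x |: E).
  rewrite mulr_sumr; apply: eq_bigr => E /andP[EK /eqP Em].
  by rewrite /mean_extension cardsD (setIidPr EK) Em.
have -> : \sum_(E : {set T} | (E \subset K) && (#|E| == m))
     \sum_(x in K :\: E) f (x |: E) =
   \sum_(E : {set T} | (E \subset K) && (#|E| == m.+1)) \sum_(x in E) f E.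
  rewrite !pair_big_dep /=.
  (* The pair of a set and a new element corresponds to the enlarged set with that element
     marked. *)
  rewrite (reindex_onto (fun u => (u.1 :\ u.2, u.2)) (fun u => (u.2 |: u.1, u.2))) /=.
    apply: eq_big => [[E x]|[E x]] /=.
      have [xE|xE] := boolP (x \in E); last first.
        rewrite !andbF; apply/negbTE; rewrite negb_and orbC; apply/orP; left.
        by apply/eqP => -[E1]; move: xE; rewrite -E1 setU11.
      rewrite setD1K // eqxx andbT !inE xE eqxx /= (cardsD1 x E) xE add1n eqSS.
      rewrite subDset -[[set x] :|: K]/(x |: K).
      have [xK|xK] := boolP (x \in K).
        have -> : x |: K = K by apply/setUidPr; rewrite sub1set.
        by rewrite !andbT.
      rewrite andbF; apply/esym/negbTE; rewrite negb_and; apply/orP; left.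
      by apply: contra xK => /andP[/subsetP/(_ _ xE)].
    by move=> /andP[_ /eqP [->]].
  move=> [E x] /andP[_]; rewrite !inE /= => /andP[xE _].
  by rewrite setU1K.
have -> : \sum_(E : {set T} | (E \subset K) && (#|E| == m.+1)) \sum_(x in E) f E =
   m.+1%:R * \sum_(E : {set T} | (E \subset K) && (#|E| == m.+1)) f E.
  rewrite mulr_sumr; apply: eq_bigr => E /andP[_ /eqP Em].
  by rewrite sumr_const Em mulr_natl.
rewrite !mulrA; congr (_ * _).
have := mul_bin_left #|K| m => /(congr1 (fun n => n%:R : R)); rewrite !natrM => H.
have n1 : ('C(#|K|, m)%:R : R) != 0 by rewrite pnatr_eq0 -lt0n bin_gt0 ltnW.
have n2 : ('C(#|K|, m.+1)%:R : R) != 0 by rewrite pnatr_eq0 -lt0n bin_gt0.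
have n3 : ((#|K| - m)%:R : R) != 0 by rewrite pnatr_eq0 subn_eq0 -ltnNge.
by rewrite -invfM mulrC [X in _ / X]mulrC -H invfM mulrA divff ?mul1r // pnatr_eq0.
Qed.

(** Couple the extensions: both sets receive the same [z] outside [x] and [y], or each receives the
    other's element. The latter yields equal sets and cancels; every other pair differs by a
    swap. *)
Lemma mean_extension_lipschitz c m f : 0 <= c ->
  swap_lipschitz c m.+1 f -> swap_lipschitz c m (mean_extension f).
Proof.
move=> c0 fc S x y SK Sm xS yS.
have [->|xy] := eqVneq x y; first by rewrite subrr.
pose Z := K :\: S :\ x :\ y.
have split_sum (u v : T) : u \in K :\: S -> v \in K :\: S -> u != v ->
    Z = K :\: S :\ u :\ v ->
    mean_extension f (u |: S) =
    (#|Z|.+1)%:R^-1 * (f (v |: (u |: S)) + \sum_(z in Z) f (u |: (z |: S))).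
  move=> uS vS uv ZE.
  have E1 : K :\: (u |: S) = K :\: S :\ u by rewrite setUC setDDl.
  have vK : v \in K :\: S :\ u by rewrite in_setD1 eq_sym uv.
  rewrite /mean_extension E1 (cardsD1 v) vK -ZE add1n (big_setD1 _ vK) /= -ZE.
  by congr (_ * (_ + _)); apply: eq_bigr => z _; rewrite setUCA.
rewrite (split_sum x y) // (split_sum y x) 1?eq_sym //; last first.
  by apply/setP => z; rewrite /Z !inE andbCA.
rewrite -mulrBr setUCA opprD addrACA subrr add0r -sumrB.
rewrite ler_pdivrMl ?ltr0Sn //.
apply: (@le_trans _ _ (\sum_(z in Z) c)).
  apply: ler_sum => z; rewrite !inE => /and4P[zy zx zS zK].
  move: xS yS; rewrite !inE => /andP[xS xK] /andP[yS yK].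
  apply: fc; rewrite ?inE ?(eq_sym x z) ?(eq_sym y z) ?negb_or ?zx ?zy ?xS ?yS //.
    by rewrite subUset sub1set zK.
  by rewrite cardsU1 zS add1n Sm.
by rewrite sumr_const -[leLHS]mulr_natl ler_wpM2r // ler_nat.
Qed.

(** Induction on [m]: Hoeffding's lemma for the last element costs one factor [expR k], and the
    averaged function has the same swap constant. *)
Lemma uniform_mean_mgf c s m f : 0 < c -> (m <= #|K|)%N ->
  swap_lipschitz c m f ->
  uniform_mean m (fun E => expR (s * f E)) <=
  expR (s * uniform_mean m f + m%:R * (s ^+ 2 * c ^+ 2 / 8)).
Proof.
move=> c0; elim: m f => [|m IH] f mK fc.
  have E0 F : uniform_mean 0 F = F set0.
    rewrite /uniform_mean bin0 invr1 mul1r (big_pred1 set0) // => E.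
    by rewrite cards_eq0 /=; case: eqVneq => [->|]; rewrite ?sub0set ?andbF.
  by rewrite !E0 mul0r addr0.
rewrite -!uniform_mean_extension //.
set k := s ^+ 2 * c ^+ 2 / 8.
have step : uniform_mean m (mean_extension (fun E => expR (s * f E))) <=
    expR k * uniform_mean m (fun E => expR (s * mean_extension f E)).
  rewrite /uniform_mean mulrCA ler_wpM2l ?invr_ge0 // mulr_sumr.
  apply: ler_sum => S /andP[SK /eqP Sm]; rewrite -expRD [k + _]addrC.
  apply: hoeffding_uniform => //.
    by rewrite -card_gt0 cardsD (setIidPr SK) Sm subn_gt0.
  by move=> x y xS yS; apply: fc; rewrite ?Sm.
apply: le_trans step _.
have := IH _ (ltnW mK) (mean_extension_lipschitz (ltW c0) fc).
rewrite -(ler_pM2l (expR_gt0 k)) => /le_trans; apply.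
rewrite -expRD ler_expR -[m.+1%:R]natr1 /k; lra.
Qed.

End UniformSubset.

(** * Random subsets with independent elements *)

Section BernoulliProduct.
Variables (R : realType) (T : finType).
Implicit Types (r : seq T) (f g : {set T} -> R).

(** Multiply by [1 - v]: the left side is at most [expR v * expR (- v) = 1], the right side is
    [1 + v ^+ 2 * (1 - 2 * v)]. *)
Lemma expR_le_quadratic (v : R) : v <= 1 / 2 -> expR v <= 1 + v + 2 * v ^+ 2.
Proof.
move=> v2; have v_lt1 : 0 < 1 - v by lra.
rewrite -(ler_pM2r v_lt1); apply: (@le_trans _ _ 1); last first.
  by have := sqr_ge0 v; nra.
rewrite -[leRHS](expRxMexpNx_1 v) ler_pM2l ?expR_gt0 //.
exact: expR_ge1Dx.
Qed.

(** Unlike in Hoeffding's lemma, the quadratic term carries a factor [p]; summed over all vertex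
    pairs it gives [mu] instead of the number of pairs. *)
Lemma bernoulli_mgf_variance (p s b1 b0 : R) : 0 <= p <= 1 ->
  s * (b1 - b0) <= 1 / 2 ->
  p * expR (s * b1) + (1 - p) * expR (s * b0) <=
  expR (s * (p * b1 + (1 - p) * b0) + 2 * p * (s * (b1 - b0)) ^+ 2).
Proof.
move=> /andP[p0 p1] v2; set v := s * (b1 - b0) in v2 *.
have -> : s * b1 = s * b0 + v by rewrite /v; ring.
have -> : s * (p * b1 + (1 - p) * b0) + 2 * p * v ^+ 2 =
  s * b0 + (p * v + 2 * p * v ^+ 2) by rewrite /v; ring.
rewrite !expRD mulrCA [(1 - p) * _]mulrC -mulrDr ler_pM2l ?expR_gt0 //.
rewrite -expRD; apply: le_trans (expR_ge1Dx _).
have := expR_le_quadratic v2; nra.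
Qed.

Variable p : R.

(** Elements are exposed one by one along a list, so that concentration is an induction;
    [bernoulli_meanE] recovers the product weights. *)
Fixpoint bernoulli_mean r f : R :=
  if r is x :: r' then p * bernoulli_mean r' (fun E => f (x |: E))
                       + (1 - p) * bernoulli_mean r' f
  else f set0.

Lemma bernoulli_meanE r f : uniq r ->
  bernoulli_mean r f = \sum_(E : {set T} | E \subset [set x in r])
    (\prod_(x <- r) (if x \in E then p else 1 - p)) * f E.
Proof.
elim: r f => [|x r IH] f /=.
  move=> _; rewrite (big_pred1 set0) ?big_nil ?mul1r // => E.
  by rewrite /= -subset0; congr (_ \subset _); apply/setP => y; rewrite !inE.
move=> /andP[xr ur]; rewrite !IH // set_cons.
have xR : x \notin [set y in r] by rewrite inE.
rewrite [RHS](bigID (fun E : {set T} => x \in E)) /=; congr (_ + _).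
  rewrite mulr_sumr.
  rewrite [RHS](reindex_onto (fun E => x |: E) (fun E => E :\ x)) /=; last first.
    by move=> E /andP[_ xE]; rewrite setD1K.
  apply: eq_big => E.
    rewrite setU11 andbT; apply/idP/andP.
      move=> ER; rewrite setUS // setU1K // ?eqxx //.
      by apply: contra xR; apply: (subsetP ER).
    move=> [/subsetP ER /eqP EE]; apply/subsetP => y yE.
    have := ER y; rewrite !inE yE orbT => /(_ isT) /orP[|//].
    by move=> /eqP yx; move: yE; rewrite -EE yx !inE eqxx.
  move=> ER; rewrite big_cons setU11 !mulrA; congr (_ * _ * _).
  apply: eq_big_seq => y yr; rewrite !inE.
  by have -> : (y == x) = false by apply: contraNF xr => /eqP <-.
rewrite mulr_sumr; apply: eq_big => E.
  apply/idP/andP.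
    move=> ER; split; first by rewrite (subset_trans ER) ?subsetUr.
    by apply: contra xR; apply: (subsetP ER).
  move=> [/subsetP ER xE]; apply/subsetP => y yE.
  have := ER y yE; rewrite !inE => /orP[|//] /eqP yx.
  by move: xE; rewrite -yx yE.
move=> ER; rewrite big_cons !mulrA; congr (_ * _ * _).
have -> // : (x \in E) = false by apply: contraNF xR; apply: (subsetP ER).
Qed.

Hypothesis p01 : 0 <= p <= 1.
Variable K : {set T}.

Lemma ler_bernoulli_mean r f g : {subset r <= K} ->
  (forall E : {set T}, E \subset K -> f E <= g E) ->
  bernoulli_mean r f <= bernoulli_mean r g.
Proof.
case/andP: p01 => p0 p1.
elim: r f g => [|x r IH] f g rK fg /=; first by rewrite fg ?sub0set.
have xK : x \in K by rewrite rK ?mem_head.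
have r'K : {subset r <= K} by move=> y yr; rewrite rK // in_cons yr orbT.
rewrite lerD // ler_wpM2l ?subr_ge0 // IH // => E EK.
by rewrite fg // subUset sub1set xK.
Qed.

Lemma bernoulli_mean_affine r f (a b : R) :
  bernoulli_mean r (fun E => a * f E + b) = a * bernoulli_mean r f + b.
Proof. by elim: r f => [|x r IH] f //=; rewrite !IH; ring. Qed.

(** The induction hypothesis handles the tail for either outcome at the head [x]; the two-point
    bound then combines the conditional means [b1] and [b0]. *)
Lemma bernoulli_mean_mgf r f (c s : R) : {subset r <= K} ->
  (forall x (E : {set T}), x \in K -> E \subset K -> `|f (x |: E) - f E| <= c) ->
  `|s| * c <= 1 / 2 ->
  bernoulli_mean r (fun E => expR (s * f E)) <=
  expR (s * bernoulli_mean r f + (size r)%:R * (2 * p * s ^+ 2 * c ^+ 2)).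
Proof.
case/andP: (p01) => p0 p1.
move=> + + sc; elim: r f => [|x r IH] f rK fc /=; first by rewrite mul0r addr0.
have xK : x \in K by rewrite rK ?mem_head.
have r'K : {subset r <= K} by move=> y yr; rewrite rK // in_cons yr orbT.
set b1 := bernoulli_mean r (fun E => f (x |: E)); set b0 := bernoulli_mean r f.
set k := 2 * p * s ^+ 2 * c ^+ 2.
have H0 := IH f r'K fc; rewrite -/b0 -/k in H0.
have H1 : bernoulli_mean r (fun E => expR (s * f (x |: E))) <= expR (s * b1 + (size r)%:R * k).
  apply: IH => // y E yK EK; rewrite setUCA fc // subUset sub1set xK //.
(* The conditional means inherit the Lipschitz constant, since averaging is monotone and commutes
   with adding a constant. *)
have bc : `|b1 - b0| <= c.
  rewrite ler_distl; apply/andP; split.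
    rewrite -[X in X - c]mul1r -bernoulli_mean_affine.
    apply: ler_bernoulli_mean => // E EK.
    by have := fc x E xK EK; rewrite ler_distl => /andP[]; lra.
  rewrite -[X in X + c]mul1r -bernoulli_mean_affine.
  apply: ler_bernoulli_mean => // E EK.
  by have := fc x E xK EK; rewrite ler_distl => /andP[]; lra.
have sb2 : `|s * (b1 - b0)| <= `|s| * c by rewrite normrM ler_wpM2l.
have sb : s * (b1 - b0) <= 1 / 2.
  by apply: le_trans sc; apply: le_trans sb2; exact: ler_norm.
apply: (@le_trans _ _ ((p * expR (s * b1) + (1 - p) * expR (s * b0)) * expR ((size r)%:R * k))).
  by rewrite [leRHS]mulrDl -!mulrA -!expRD lerD // ler_wpM2l ?subr_ge0.
apply: (@le_trans _ _ (expR (s * (p * b1 + (1 - p) * b0)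
  + 2 * p * (s * (b1 - b0)) ^+ 2) * expR ((size r)%:R * k))).
  by rewrite ler_pM2r ?expR_gt0 // bernoulli_mgf_variance.
have vk : 2 * p * (s * (b1 - b0)) ^+ 2 <= k.
  have -> : k = 2 * p * (s * c) ^+ 2 by rewrite /k; ring.
  rewrite ler_wpM2l ?mulr_ge0 //.
  rewrite -[leLHS]real_normK ?num_real // -[leRHS]real_normK ?num_real //.
  rewrite lerXn2r ?nnegrE // normrM [leRHS]normrM ler_wpM2l //.
  by rewrite (le_trans bc) // ler_norm.
rewrite -expRD ler_expR -[(size r).+1%:R]natr1 -/b1 -/b0 -/k.
move: (s * (p * b1 + _)) (2 * p * _ ^+ 2) k vk {H0 H1} => X v k' vk; lra.
Qed.

End BernoulliProduct.

(** * Modularity as a function of the edge set *)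

Section Score.
Variables (R : realFieldType) (V : finType).
Implicit Types (e A : {set V}) (E P : {set {set V}}).

(** The degree sum counted edge by edge, so that a new edge contributes a single term. *)
Definition volume E A : R := \sum_(e in E) #|e :&: A|%:R.

Definition inside P e : R := \sum_(A in P) (e \subset A)%:R.

Definition score E P : R :=
  #|E|%:R^-1 * (\sum_(e in E) inside P e)
  - (4 * #|E|%:R ^+ 2)^-1 * (\sum_(A in P) volume E A ^+ 2).

Lemma modularity_score (G : graph V) P : modularity R G P = score (edges G) P.
Proof.
rewrite /modularity /score; congr (_ * _ - _ * _).
  rewrite exchange_big; apply: eq_bigr => A _ /=.
  rewrite /edges_within -sum1_card natr_sum big_mkcond [RHS]big_mkcond /=.
  apply: eq_bigr => e _; rewrite inE.
  by case: (e \in edges G) => //=; case: (e \subset A).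
apply: eq_bigr => A _; congr (_ ^+ 2); rewrite /vol /volume -natr_sum; congr _%:R.
under eq_bigr => v _ do rewrite /degree -sum1_card.
rewrite (exchange_big_dep (mem (edges G))) /=; last first.
  by move=> v e _; rewrite inE => /andP[].
apply: eq_bigr => e eG; rewrite -sum1_card; apply: eq_bigl => v.
by rewrite !inE eG andbC.
Qed.

Definition max_score E : R :=
  \big[Num.max/score E [set [set: V]]]_(P : {set {set V}} | partition P [set: V]) score E P.

Lemma max_modularity_score (G : graph V) : max_modularity R G = max_score (edges G).
Proof.
rewrite /max_modularity /max_score.
case: eqVneq => [->|_]; last first.
  by rewrite modularity_score; apply: eq_bigr => P _; rewrite modularity_score.
(* Since [0^-1 = 0], every score of the empty edge set is 0, in agreement with the special case of
   [max_modularity]. *)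
have s0 P : score set0 P = 0.
  by rewrite /score cards0 expr0n mulr0 invr0 !mul0r subrr.
by rewrite s0; under eq_bigr => P _ do rewrite s0; elim/big_ind: _ => // x y <- <-; rewrite maxxx.
Qed.

(* The one-block family starts the maximum defining [max_modularity]; it fails
   to be a partition when [V] is empty. *)
Definition admissible P := partition P [set: V] || (P == [set [set: V]]).

Lemma score_le_max E P : admissible P -> score E P <= max_score E.
Proof.
case/orP => [hP|/eqP ->]; last exact: bigmax_ge_id.
exact: le_bigmax_cond.
Qed.

Lemma max_score_attained E : exists2 P, admissible P & max_score E = score E P.
Proof.
rewrite /max_score; elim/big_ind: _ => [|x y [P hP ->] [Q hQ ->]|P hP].
- by exists [set [set: V]]; rewrite // /admissible eqxx orbT.
- by case: leP => _; [exists Q | exists P].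
- by exists P; rewrite // /admissible hP.
Qed.

Lemma admissible_cover P v : admissible P -> \sum_(A in P) (v \in A)%:R = 1 :> R.
Proof.
case/orP => [/and3P[/eqP cP tP _]|/eqP ->]; last by rewrite big_set1 inE.
have vP : v \in cover P by rewrite cP inE.
rewrite (bigD1 (pblock P v)) ?pblock_mem //= mem_pblock vP big1 ?addr0 //.
move=> A /andP[AP]; apply: contraNeq; rewrite pnatr_eq0 eqb0 negbK => vA.
by rewrite (def_pblock tP AP vA).
Qed.

Section FixedPartition.
Variable P : {set {set V}}.
Hypothesis admP : admissible P.

Lemma overlap_sum e : \sum_(A in P) #|e :&: A|%:R = #|e|%:R :> R.
Proof.
have -> : #|e|%:R = \sum_(v in e) (1 : R) by rewrite sumr_const.
under [RHS]eq_bigr => v _ do rewrite -(admissible_cover v admP).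
rewrite exchange_big /=; apply: eq_bigr => A _.
rewrite -sum1_card natr_sum [RHS]big_mkcond [LHS]big_mkcond /=.
by apply: eq_bigr => v _; rewrite inE; case: (v \in e) => //=; case: (v \in A).
Qed.

Lemma inside_ge0 e : 0 <= inside P e.
Proof. by apply: sumr_ge0 => A _. Qed.

Lemma inside_le1 e : e != set0 -> inside P e <= 1.
Proof.
case/set0Pn => v ve; rewrite -(admissible_cover v admP); apply: ler_sum => A _.
rewrite ler_nat; case: (boolP (e \subset A)) => // /subsetP/(_ _ ve) ->.
by [].
Qed.

(** The overlap is 0, 1 or 2, and it is 2 exactly when [e] lies in [A]. *)
Lemma overlap_sqr e A : #|e| = 2%N ->
  #|e :&: A|%:R ^+ 2 = #|e :&: A|%:R + 2 * (e \subset A)%:R :> R.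
Proof.
move=> e2; have : (#|e :&: A| <= 2)%N by rewrite -e2 subset_leq_card ?subsetIl.
have -> : (e \subset A) = (#|e :&: A| == 2%N).
  rewrite -e2; apply/idP/eqP => [/setIidPl -> //|eq].
  by apply/setIidPl/eqP; rewrite eqEcard subsetIl eq leqnn.
by case: #|_| => [|[|[|//]]] _ /=; ring.
Qed.

Lemma overlap_le e A : #|e| = 2%N -> A \in P ->
  #|e :&: A|%:R <= 1 + inside P e.
Proof.
move=> e2 AP.
have eA : (e \subset A)%:R <= inside P e.
  by rewrite /inside (bigD1 A) //= lerDl sumr_ge0.
apply: le_trans (_ : 1 + (e \subset A)%:R <= _); last by rewrite lerD2l.
rewrite -[1 + _](natrD R 1%N) ler_nat.
have le2 : (#|e :&: A| <= 2)%N by rewrite -e2 subset_leq_card ?subsetIl.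
case: (boolP (e \subset A)) => //= /negP eA'; rewrite -ltnS ltn_neqAle le2 andbT.
apply/eqP => eq; apply: eA'; apply/setIidPl/eqP.
by rewrite eqEcard subsetIl eq e2.
Qed.

Lemma volume_ge0 E A : 0 <= volume E A.
Proof. exact: sumr_ge0. Qed.

Lemma volumeU1 e E A : e \notin E ->
  volume (e |: E) A = #|e :&: A|%:R + volume E A.
Proof. exact: big_setU1. Qed.

Definition all_pairs E := {in E, forall e, #|e| = 2%N}.

Lemma volume_sum E : all_pairs E -> \sum_(A in P) volume E A = 2 * #|E|%:R.
Proof.
move=> E2; rewrite exchange_big /=.
under eq_bigr => e eE do rewrite overlap_sum E2 //.
by rewrite sumr_const mulr_natr.
Qed.

Lemma volume_sqr_sum_le E : all_pairs E ->
  \sum_(A in P) volume E A ^+ 2 <= 4 * #|E|%:R ^+ 2.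
Proof.
move=> E2; have -> : 4 * #|E|%:R ^+ 2 = \sum_(A in P) volume E A * (2 * #|E|%:R) :> R.
  by rewrite -mulr_suml volume_sum //; ring.
apply: ler_sum => A AP; rewrite expr2 ler_wpM2l ?volume_ge0 //.
rewrite -(volume_sum E2) (bigD1 A) //= lerDl sumr_ge0 // => B _; exact: volume_ge0.
Qed.

Lemma inside_sum_le E : all_pairs E -> \sum_(e in E) inside P e <= #|E|%:R.
Proof.
move=> E2; rewrite -[leRHS]sumr_const; apply: ler_sum => e eE.
by rewrite inside_le1 // -card_gt0 E2.
Qed.

(** Expand the squares; [w] is the cross term. Its bound keeps [inside P e], because an overlap of 2
    occurs only for an edge within a block. *)
Lemma volume_sqr_sumU1 e E : #|e| = 2%N -> e \notin E -> all_pairs E ->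
  exists2 w : R, 0 <= w <= 2 * #|E|%:R * (1 + inside P e) &
  \sum_(A in P) volume (e |: E) A ^+ 2 =
  \sum_(A in P) volume E A ^+ 2 + 2 * w + 2 + 2 * inside P e.
Proof.
move=> e2 eE E2; exists (\sum_(A in P) volume E A * #|e :&: A|%:R).
  apply/andP; split; first by apply: sumr_ge0 => A _; rewrite mulr_ge0 ?volume_ge0.
  rewrite -volume_sum // mulr_suml; apply: ler_sum => A AP.
  by rewrite ler_wpM2l ?volume_ge0 // overlap_le.
have ov2 : \sum_(A in P) #|e :&: A|%:R ^+ 2 = 2 + 2 * inside P e.
  under eq_bigr => A _ do rewrite overlap_sqr //.
  by rewrite big_split -mulr_sumr overlap_sum e2.
rewrite -[_ + 2 + _]addrA -ov2 -addrA mulr_sumr -!big_split /=; apply: eq_bigr => A _.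
rewrite volumeU1 //; ring.
Qed.

(** If [e2] lies within a block, the volume term may gain almost [2 / m], but then the edge term
    gains nothing; otherwise each gains at most [1 / m]. Separate worst cases would not give the
    constant 2. *)
Lemma score_swap (e1 e2 : {set V}) E :
  #|e1| = 2%N -> #|e2| = 2%N -> e1 \notin E -> e2 \notin E -> all_pairs E ->
  score (e1 |: E) P - score (e2 |: E) P <= 2 / #|E|.+1%:R.
Proof.
move=> c1 c2 n1 n2 E2; rewrite /score !cardsU1 n1 n2 !add1n !big_setU1 //=.
have [w1 /andP[w1_ge0 w1_le] ->] := volume_sqr_sumU1 c1 n1 E2.
have [w2 /andP[w2_ge0 w2_le] ->] := volume_sqr_sumU1 c2 n2 E2.
have i1 : inside P e1 <= 1 by rewrite inside_le1 // -card_gt0 c1.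
have i2 := inside_ge0 e2.
have h0 : 0 <= #|E|%:R :> R by [].
move: w1_le w2_le i1 i2 (inside_ge0 e1); rewrite -[#|E|.+1%:R]natr1.
move: (inside P e1) (inside P e2) (\sum_(A in P) _) (\sum_(e in E) _) h0.
move: (#|E|%:R : R) => h x1 x2 Q I h0 w1_le w2_le i1 i2 i3.
have m0 : 0 < h + 1 by lra.
have m_neq0 : h + 1 != 0 by rewrite gt_eqF.
have c0 : 0 < 4 * (h + 1) ^+ 2 by rewrite mulr_gt0 // exprn_gt0.
rewrite -(ler_pM2l c0).
have -> : 4 * (h + 1) ^+ 2 * ((h + 1)^-1 * (x1 + I) - (4 * (h + 1) ^+ 2)^-1 * (Q + 2 * w1 + 2 + 2 * x1)
  - ((h + 1)^-1 * (x2 + I) - (4 * (h + 1) ^+ 2)^-1 * (Q + 2 * w2 + 2 + 2 * x2)))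
  = 4 * (h + 1) * (x1 - x2) - 2 * w1 - 2 * x1 + 2 * w2 + 2 * x2 by field.
have -> : 4 * (h + 1) ^+ 2 * (2 / (h + 1)) = 8 * (h + 1) by field.
nra.
Qed.

(** Multiplying by the number of edges makes the change bounded independently of that number; this
    product is the numerator of [damped_score]. *)
Lemma score_add (e : {set V}) E :
  #|e| = 2%N -> e \notin E -> all_pairs E ->
  `|#|E|.+1%:R * score (e |: E) P - #|E|%:R * score E P| <= 2.
Proof.
move=> c1 n1 E2; rewrite /score !cardsU1 n1 !add1n !big_setU1 //=.
have [w /andP[w_ge0 w_le] ->] := volume_sqr_sumU1 c1 n1 E2.
have i1 : inside P e <= 1 by rewrite inside_le1 // -card_gt0 c1.
have i0 := inside_ge0 e.
have h0 : 0 <= #|E|%:R :> R by [].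
have Q0 : 0 <= \sum_(A in P) volume E A ^+ 2 by apply: sumr_ge0 => A _; rewrite sqr_ge0.
have Qh := volume_sqr_sum_le E2.
have I0 : \sum_(e in E) inside P e <= #|E|%:R := inside_sum_le E2.
have I1 : 0 <= \sum_(e in E) inside P e by apply: sumr_ge0 => A _; exact: inside_ge0.
move: w_le i1 i0 Q0 Qh I0 I1; rewrite -[#|E|.+1%:R]natr1.
move: (inside P e) (\sum_(A in P) _) (\sum_(e in E) _) h0.
move: (#|E|%:R : R) => h x Q I h0 w_le i1 i0 Q0 Qh I0 I1.
have m0 : 0 < h + 1 by lra.
have m_neq0 : h + 1 != 0 by rewrite gt_eqF.
have -> : (h + 1) * ((h + 1)^-1 * (x + I) - (4 * (h + 1) ^+ 2)^-1 * (Q + 2 * w + 2 + 2 * x))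
   = x + I - (Q + 2 * w + 2 + 2 * x) / (4 * (h + 1)) by field.
(* The volume term times the number of edges is [q = Q / (4 * h)]; without edges it is 0 and the
   division must be avoided. *)
have [q [q0 qh Qq ->]] : exists q, [/\ 0 <= q, q <= h, Q = 4 * h * q &
   h * (h^-1 * I - (4 * h ^+ 2)^-1 * Q) = I - q].
  have [hE|h_neq0] := eqVneq h 0.
    by exists 0; rewrite hE in Qh I0 *; split=> //; nra.
  have h_gt0 : 0 < h by rewrite lt_def h_neq0.
  exists (Q / (4 * h)); split; [by rewrite divr_ge0 // mulr_ge0| | by field | by field].
  rewrite ler_pdivrMr ?mulr_gt0 //; lra.
have c0 : 0 < 4 * (h + 1) by rewrite mulr_gt0.
rewrite -(ler_pM2l c0) -{1}(gtr0_norm c0) -normrM Qq.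
have -> : 4 * (h + 1) * (x + I - (4 * h * q + 2 * w + 2 + 2 * x) / (4 * (h + 1)) - (I - q)) =
  4 * (h + 1) * x + 4 * q - 2 * w - 2 - 2 * x by field.
rewrite ler_norml; apply/andP; split; nra.
Qed.

Lemma score_le1 E : all_pairs E -> score E P <= 1.
Proof.
move=> E2; rewrite /score; apply: (@le_trans _ _ (#|E|%:R^-1 * \sum_(e in E) inside P e)).
  rewrite lerBlDr lerDl mulr_ge0 ?invr_ge0 ?mulr_ge0 //.
  by apply: sumr_ge0 => A _; rewrite sqr_ge0.
have [->|E0] := eqVneq E set0; first by rewrite cards0 invr0 mul0r.
rewrite ler_pdivrMl ?mulr1 ?inside_sum_le // ltr0n card_gt0 //.
Qed.

End FixedPartition.

(** One block has edge term and volume term both 1 (both 0 without edges); hence [max_score] is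
    nonnegative. *)
Lemma score_trivial E : all_pairs E -> score E [set [set: V]] = 0.
Proof.
move=> E2; rewrite /score !big_set1.
have -> : volume E [set: V] = 2 * #|E|%:R.
  rewrite /volume; under eq_bigr => e eE do rewrite setIT E2 //.
  by rewrite sumr_const mulr_natr.
have -> : \sum_(e in E) inside [set [set: V]] e = #|E|%:R.
  under eq_bigr => e _ do rewrite /inside big_set1 subsetT.
  by rewrite sumr_const.
have [->|E0] := eqVneq E set0; first by rewrite cards0 !mulr0 expr0n /= mulr0 subrr.
have m0 : #|E|%:R != 0 :> R by rewrite pnatr_eq0 -lt0n card_gt0.
by field.
Qed.

Lemma max_score_bounds E : all_pairs E -> 0 <= max_score E <= 1.
Proof.
move=> E2; apply/andP; split.
  by rewrite -(score_trivial E2) score_le_max // /admissible eqxx orbT.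
by have [P hP ->] := max_score_attained E; exact: score_le1.
Qed.

(** Both scores are compared at a partition optimal for the first edge set. *)
Lemma max_score_swap (e1 e2 : {set V}) E :
  #|e1| = 2%N -> #|e2| = 2%N -> e1 \notin E -> e2 \notin E -> all_pairs E ->
  max_score (e1 |: E) - max_score (e2 |: E) <= 2 / #|E|.+1%:R.
Proof.
move=> c1 c2 n1 n2 E2; have [P hP ->] := max_score_attained (e1 |: E).
apply: le_trans (score_swap hP c1 c2 n1 n2 E2).
by rewrite lerD2l lerN2 score_le_max.
Qed.

Lemma max_score_add (e : {set V}) E :
  #|e| = 2%N -> e \notin E -> all_pairs E ->
  `|#|E|.+1%:R * max_score (e |: E) - #|E|%:R * max_score E| <= 2.
Proof.
move=> c1 n1 E2; rewrite ler_norml; apply/andP; split.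
  have [P hP eqP] := max_score_attained E.
  have := score_add hP c1 n1 E2; rewrite ler_norml => /andP[+ _] => /le_trans; apply.
  by rewrite eqP lerD2r ler_wpM2l // score_le_max.
have [P hP ->] := max_score_attained (e |: E).
have := score_add hP c1 n1 E2; rewrite ler_norml => /andP[_]; apply: le_trans.
by rewrite lerD2l lerN2 ler_wpM2l // score_le_max.
Qed.

End Score.

(** * Concentration for the two random graph models *)

Section FiniteExpectation.
Variables (R : realFieldType) (T : finType) (P : T -> R).
Hypothesis P_pmf : is_pmf P.
Implicit Types (X Y : T -> R) (A B : pred T).

Lemma Ex_ge0 X : (forall x, 0 <= X x) -> 0 <= Ex P X.
Proof. by case: P_pmf => P0 _ X0; apply: sumr_ge0 => x _; rewrite mulr_ge0. Qed.

Lemma ler_Ex X Y : (forall x, X x <= Y x) -> Ex P X <= Ex P Y.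
Proof. by case: P_pmf => P0 _ XY; apply: ler_sum => x _; rewrite ler_wpM2l. Qed.

Lemma Ex_cst (c : R) : Ex P (fun=> c) = c.
Proof. by case: P_pmf => _ P1; rewrite /Ex -mulr_suml P1 mul1r. Qed.

Lemma ExB X Y : Ex P (fun x => X x - Y x) = Ex P X - Ex P Y.
Proof. by rewrite /Ex -sumrB; apply: eq_bigr => x _; rewrite mulrBr. Qed.

Lemma Pr_Ex A : Pr P A = Ex P (fun x => (A x)%:R).
Proof.
by rewrite /Pr big_mkcond; apply: eq_bigr => x _; case: ifP; rewrite ?mulr1 ?mulr0.
Qed.

Lemma Pr_lt2 A : Pr P A < 2.
Proof.
apply: (@le_lt_trans _ _ 1); last by rewrite ltr1n.
by rewrite Pr_Ex -[leRHS]Ex_cst; apply: ler_Ex => x; case: (A x).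
Qed.

(* [X = Y] off [B], and the means differ by at most [Pr P B]. *)
Lemma deviation_transfer X Y B (t : R) :
  (forall x, 0 <= X x - Y x <= (B x)%:R) -> Pr P B <= t / 2 ->
  Pr P (fun x => t <= `|X x - Ex P X|) <=
  Pr P (fun x => t / 2 <= `|Y x - Ex P Y|) + Pr P B.
Proof.
move=> XYB Bt.
have E0 : 0 <= Ex P X - Ex P Y by rewrite -ExB Ex_ge0 // => x; case/andP: (XYB x).
have E1 : Ex P X - Ex P Y <= t / 2.
  by apply: le_trans Bt; rewrite -ExB Pr_Ex; apply: ler_Ex => x; case/andP: (XYB x).
rewrite !Pr_Ex /Ex -big_split /=; case: P_pmf => P0 _; apply: ler_sum => x _.
rewrite -mulrDr ler_wpM2l // -natrD ler_nat.
have := XYB x; case: (B x) => /andP[d0 d1]; first by rewrite addn1; apply: leq_trans (leq_b1 _) _.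
rewrite addn0; move: d0 d1; rewrite /= => d0 d1.
have -> : X x = Y x by lra.
case: leP => // tX; case: leP => //; rewrite real_ltNge ?num_real //.
have := ler_normD (Y x - Ex P Y) (Ex P Y - Ex P X); rewrite addrA subrK.
rewrite [`|Ex P Y - Ex P X|]ler0_norm; last by lra.
move=> Hn /negP[]; lra.
Qed.

End FiniteExpectation.

(** * Random graphs as random sets of vertex pairs *)

Section GraphSums.
Variables (R : realType) (n : nat).

Definition vertex_pairs : {set {set 'I_n}} := [set e : {set 'I_n} | #|e| == 2%N].

Lemma card_vertex_pairs : #|vertex_pairs| = 'C(n, 2).
Proof. by rewrite card_draws card_ord. Qed.

Lemma edges_subset (G : graph 'I_n) : edges G \subset vertex_pairs.
Proof.
by apply/subsetP => e eG; rewrite inE; have /forall_inP/(_ _ eG) := edges_card2 G.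
Qed.

Lemma subset_all_pairs (E : {set {set 'I_n}}) : E \subset vertex_pairs -> all_pairs E.
Proof. by move=> /subsetP EK e /EK; rewrite inE => /eqP. Qed.

(** [edges] is a bijection onto the sets of vertex pairs; the empty graph is the default of the
    inverse off its domain. *)
Lemma sum_graph (F : {set {set 'I_n}} -> R) (Q : pred {set {set 'I_n}}) :
  \sum_(G : graph 'I_n | Q (edges G)) F (edges G) =
  \sum_(E : {set {set 'I_n}} | (E \subset vertex_pairs) && Q E) F E.
Proof.
have h0 : [forall e in set0, #|e : {set 'I_n}| == 2%N].
  by apply/forall_inP => e; rewrite inE.
rewrite [RHS](reindex_onto (@edges 'I_n) (insubd (Graph h0))) /=; last first.
  move=> E /andP[/subsetP EK _]; rewrite [LHS]insubdK //.
  by apply/forall_inP => e /EK; rewrite inE.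
by apply: eq_bigl => G; rewrite edges_subset (valKd (Graph h0) G) eqxx andbT.
Qed.

Lemma Ex_Gnm m (f : {set {set 'I_n}} -> R) :
  Ex (@Gnm R n m) (fun G => f (edges G)) = uniform_mean vertex_pairs m f.
Proof.
rewrite /Ex /Gnm /uniform_mean mulr_sumr -sum_graph [RHS]big_mkcond /=.
apply: eq_bigr => G _; case: ifP => _; last by rewrite mul0r.
congr (_%:R^-1 * _); rewrite -cards_draws -!sum1_card.
(* The cardinalities are compared after embedding into [R], where [sum_graph] with constant summand
   1 counts graphs. *)
apply: (mulrIn (oner_neq0 R)); rewrite !natr_sum.
have := sum_graph (fun=> 1) (fun E => #|E| == m).
by under eq_bigl => H do rewrite inE; move=> ->; apply: eq_bigl => E; rewrite inE.
Qed.

Lemma Ex_Gnp p (f : {set {set 'I_n}} -> R) :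
  Ex (@Gnp R n p) (fun G => f (edges G)) =
  bernoulli_mean p (enum vertex_pairs) f.
Proof.
rewrite bernoulli_meanE ?enum_uniq //.
have -> : [set x in enum vertex_pairs] = vertex_pairs.
  by apply/setP => e; rewrite inE mem_enum.
have := sum_graph (fun E => (\prod_(x <- enum vertex_pairs) (if x \in E then p else 1 - p)) * f E) predT.
under [RHS]eq_bigl do rewrite andbT.
move=> <-; apply: eq_bigr => G _; congr (_ * _).
by rewrite /Gnp big_enum /=; apply: eq_bigl => e; rewrite inE.
Qed.

End GraphSums.

Lemma eq_bernoulli_mean (R : realType) (T : finType) (p : R) (r : seq T) f g :
  0 <= p <= 1 -> (forall E : {set T}, E \subset [set x in r] -> f E = g E) ->
  bernoulli_mean p r f = bernoulli_mean p r g.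
Proof.
move=> p01 fg; have rK : {subset r <= [set x in r]} by move=> x; rewrite inE.
by apply: le_anti; rewrite !(ler_bernoulli_mean p01 rK) // => E /fg ->.
Qed.

Lemma bernoulli_mean_card (R : realType) (T : finType) (p : R) (r : seq T) :
  0 <= p <= 1 -> uniq r ->
  bernoulli_mean p r (fun E => #|E|%:R) = (size r)%:R * p.
Proof.
move=> p01; elim: r => [|x r IH] /=; first by rewrite cards0 mul0r.
move=> /andP[xr ur]; rewrite IH //.
have -> : bernoulli_mean p r (fun E => #|x |: E|%:R) =
    bernoulli_mean p r (fun E => 1 * #|E|%:R + 1).
  apply: eq_bernoulli_mean => // E ER.
  rewrite cardsU1 natrD mul1r addrC; congr (_ + _).
  by have -> : x \notin E by apply: contra xr => /(subsetP ER); rewrite inE.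
by rewrite bernoulli_mean_affine IH // -[(size r).+1%:R]natr1; ring.
Qed.

Lemma Gnm_concentration (R : realType) (n m : nat) (t : R) :
  (m <= 'C(n, 2))%N -> 0 < t ->
  Pr (@Gnm R n m)
    (fun G => t <= `|max_modularity R G - Ex (@Gnm R n m) (@max_modularity R _)|) <
  2 * expR (- (t ^+ 2 * m%:R / 2)).
Proof.
move=> mn t0; set P := @Gnm R n m; pose q := @max_modularity R 'I_n.
have P_pmf : is_pmf P := Gnm_pmf R mn.
(* For [m = 0] the bound is 2, above any probability. *)
have [->|m0] := posnP m; first by rewrite mulr0 mul0r oppr0 expR0 mulr1; exact: Pr_lt2.
have m_gt0 : 0 < m%:R :> R by rewrite ltr0n.
have qE : q =1 (fun G => max_score R (edges G)) := @max_modularity_score R _.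
have mgf (s : R) : Ex P (fun G => expR (s * q G)) <=
    expR (s * Ex P q + m%:R * (s ^+ 2 * (2 / m%:R) ^+ 2 / 8)).
  have -> : Ex P (fun G => expR (s * q G)) =
     Ex P (fun G => expR (s * max_score R (edges G))).
    by apply: eq_bigr => G _; rewrite qE.
  have -> : Ex P q = Ex P (fun G => max_score R (edges G)).
    by apply: eq_bigr => G _; rewrite qE.
  rewrite (Ex_Gnm m (fun E => expR (s * max_score R E))) (Ex_Gnm m (@max_score R _)).
  apply: uniform_mean_mgf; rewrite ?card_vertex_pairs ?divr_gt0 //.
  move=> S x y SK Sm; rewrite !inE => /andP[xS /eqP x2] /andP[yS /eqP y2].
  by rewrite -Sm; apply: max_score_swap => //; exact: subset_all_pairs.
(* The value [s = t * m] minimises the exponent [s ^+ 2 / (2 * m) - s * t]. *)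
have s0 : 0 <= t * m%:R by rewrite mulr_ge0 // ltW.
have H1 := mgf (t * m%:R); have := mgf (- (t * m%:R)); rewrite sqrrN => H2.
have -> : - (t ^+ 2 * m%:R / 2) =
    m%:R * ((t * m%:R) ^+ 2 * (2 / m%:R) ^+ 2 / 8) - t * m%:R * t.
  by field; rewrite gt_eqF.
exact: chernoff_two_sided P_pmf s0 H1 H2.
Qed.

(** * Lipschitz functions of the binomial random graph *)

Section GnpConcentration.
Variables (R : realType) (n : nat) (p : R).
Hypothesis p01 : 0 < p < 1.
Let P := @Gnp R n p.
Let K := vertex_pairs n.
Let mu : R := 'C(n, 2)%:R * p.

Let p01W : 0 <= p <= 1.
Proof. by case/andP: p01 => /ltW -> /ltW ->. Qed.

Let P_pmf : is_pmf P := Gnp_pmf n p01W.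

Lemma Gnp_lipschitz_deviation (f : {set {set 'I_n}} -> R) (c s t : R) :
  (forall x (E : {set {set 'I_n}}), x \in K -> E \subset K ->
     `|f (x |: E) - f E| <= c) ->
  0 <= s -> s * c <= 1 / 2 ->
  Pr P (fun G => t <= `|f (edges G) - Ex P (fun H => f (edges H))|) <
  2 * expR (2 * mu * (s * c) ^+ 2 - s * t).
Proof.
move=> fc s0 sc.
have rK : {subset enum K <= K} by move=> e; rewrite mem_enum.
have mgf u : `|u| = s -> Ex P (fun G => expR (u * f (edges G))) <=
    expR (u * Ex P (fun G => f (edges G)) + 2 * mu * (s * c) ^+ 2).
  move=> us; rewrite (Ex_Gnp p (fun E => expR (u * f E))) Ex_Gnp.
  have uc : `|u| * c <= 1 / 2 by rewrite us.
  apply: le_trans (bernoulli_mean_mgf p01W rK fc uc) _.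
  rewrite ler_expR lerD2l -cardE card_vertex_pairs -us exprMn real_normK ?num_real //.
  by rewrite le_eqVlt; apply/orP; left; apply/eqP; rewrite /mu; ring.
apply: chernoff_two_sided => //; apply: mgf; first exact: ger0_norm.
by rewrite normrN ger0_norm.
Qed.

Lemma Ex_edges : Ex P (fun G => #|edges G|%:R) = mu.
Proof.
rewrite (Ex_Gnp p (fun E => #|E|%:R)) bernoulli_mean_card ?enum_uniq //.
by rewrite -cardE card_vertex_pairs.
Qed.

End GnpConcentration.

Section DampedScore.
Variables (R : realFieldType) (n : nat) (L : R).
Hypothesis L_gt0 : 0 < L.

Definition damped_score (E : {set {set 'I_n}}) : R :=
  #|E|%:R * max_score R E / Num.max #|E|%:R (L).

(** The numerator moves by at most 2 and the denominator by at most 1, the latter weighted by a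
    ratio in the unit interval; the sum 3 is divided by a denominator of at least [L]. *)
Lemma damped_score_lipschitz x (E : {set {set 'I_n}}) : x \in vertex_pairs n -> E \subset vertex_pairs n ->
  `|damped_score (x |: E) - damped_score E| <= 3 / L.
Proof.
rewrite inE => /eqP x2 EK.
have c0 : 0 < 3 / L by rewrite divr_gt0.
have [xE|xE] := boolP (x \in E).
  have -> : x |: E = E by apply/setUidPr; rewrite sub1set.
  by rewrite subrr normr0 ltW.
have E2 := subset_all_pairs EK.
have H := max_score_add R x2 xE E2.
have /andP[q0 q1] := max_score_bounds R E2.
rewrite /damped_score cardsU1 xE add1n.
move: H q0 q1; set a := max_score R (x |: E); set b := max_score R E.
rewrite -[#|E|.+1%:R]natr1; move: a b (#|E|%:R) (ler0n R #|E|) => a b h h0 H q0 q1.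
set M := Num.max (h + 1) _; set M0 := Num.max h _.
have M0L : L <= M0 by rewrite le_max lexx orbT.
have M0h : h <= M0 by rewrite le_max lexx.
have MM : M0 <= M by rewrite ge_max !le_max lexx orbT andbT lerDl ler01.
have MM1 : M <= M0 + 1.
  rewrite ge_max lerD2r M0h /=; apply: le_trans M0L _; by rewrite lerDl.
have M0_gt0 : 0 < M0 := lt_le_trans L_gt0 M0L.
have M_gt0 : 0 < M := lt_le_trans M0_gt0 MM.
move: M M0 M_gt0 M0_gt0 MM1 MM M0h M0L => M M0 M_gt0 M0_gt0 MM1 MM M0h M0L.
apply: (@le_trans _ _ (3 / M)); last first.
  by rewrite ler_pM2l // lef_pV2 ?posrE // (le_trans M0L).
rewrite -(ler_pM2r M_gt0) divfK ?gt_eqF // -[X in _ * X <= _](gtr0_norm M_gt0) -normrM.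
have -> : ((h + 1) * a / M - h * b / M0) * M =
  ((h + 1) * a - h * b) - h * b / M0 * (M - M0).
  by field; rewrite !gt_eqF.
have r01 : 0 <= h * b / M0 <= 1.
  rewrite divr_ge0 ?mulr_ge0 ?(ltW M0_gt0) //= ler_pdivrMr // mul1r.
  by apply: le_trans M0h; rewrite ler_piMr.
move: (h * b / M0) r01 => r /andP[r0 r1].
apply: le_trans (ler_normB _ _) _.
rewrite [X in _ + X]ger0_norm; last by rewrite mulr_ge0 // subr_ge0.
have : r * (M - M0) <= 1 by nra.
lra.
Qed.

End DampedScore.

Lemma Gnp_concentration (R : realType) (n : nat) (p t : R) :
  0 < p < 1 -> 0 <= t ->
  Pr (@Gnp R n p)
    (fun G => t <= `|max_modularity R G - Ex (@Gnp R n p) (@max_modularity R _)|) <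
  2 * expR (- (4608^-1 * ('C(n, 2)%:R * p) * t ^+ 2)).
Proof.
move=> p01 t0; set P := @Gnp R n p; pose q := @max_modularity R 'I_n.
set mu := _%:R * p.
have p01W : 0 <= p <= 1 by case/andP: p01 => /ltW -> /ltW ->.
have P_pmf : is_pmf P := Gnp_pmf n p01W.
have mu_ge0 : 0 <= mu by rewrite mulr_ge0 //; case/andP: p01W.
have q01 G : 0 <= q G <= 1.
  rewrite /q max_modularity_score; apply: max_score_bounds.
  exact: subset_all_pairs (edges_subset G).
have Eq01 : 0 <= Ex P q <= 1.
  rewrite -[X in _ && (_ <= X)](Ex_cst P_pmf 1); apply/andP; split.
    by apply: (Ex_ge0 P_pmf) => G; case/andP: (q01 G).
  by apply: (ler_Ex P_pmf) => G; case/andP: (q01 G).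
(* Below 2304, half of 4608, the right-hand side exceeds [2 * (1 - 1 / 2) = 1]. *)
have [x_lt|x_ge] := ltP (mu * t ^+ 2) 2304.
  have Pr1 A : Pr P A <= 1.
    by rewrite Pr_Ex -[leRHS](Ex_cst P_pmf); apply: ler_Ex => // x; case: (A x).
  apply: le_lt_trans (Pr1 _) _.
  have := expR_ge1Dx (- (4608^-1 * mu * t ^+ 2)); lra.
(* Scores and their mean lie in the unit interval, so the event is empty for [t > 1]. *)
have [t1|t1] := ltP 1 t.
  rewrite /Pr big_pred0 ?mulr_gt0 ?expR_gt0 // => G; apply/negbTE; rewrite -ltNge.
  apply: le_lt_trans t1; rewrite -/(q G) -/q ler_norml.
  have := q01 G; move: Eq01 => /andP[? ?] /andP[? ?]; apply/andP; split; lra.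
have mu_ge : 2304 <= mu.
  by apply: le_trans x_ge _; rewrite ler_piMr // expr_le1.
have mu_gt0 : 0 < mu by lra.
have t_gt0 : 0 < t.
  by rewrite lt_def t0 andbT; apply: contraTneq x_ge => ->; rewrite expr0n mulr0 -ltNge ltr0n.
pose Y (G : graph 'I_n) := damped_score (mu / 2) (edges G).
pose B (G : graph 'I_n) := mu / 2 <= `|#|edges G|%:R - mu|.
(* The edge count has Lipschitz constant 1; [s = 1 / 8] is optimal for a deviation of [mu / 2]. *)
have PB : Pr P B < 2 * expR (- (mu / 32)).
  have := @Gnp_lipschitz_deviation R n p p01 (fun E => #|E|%:R) 1 (1 / 8) (mu / 2).
  rewrite Ex_edges // -/P -/mu => H.
  apply: lt_le_trans (H _ _ _) _ => [x E _ _||| ]; try lra.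
  - rewrite cardsU1 natrD addrK; case: (x \notin E) => /=.
      by rewrite normr1.
    by rewrite normr0.
  - by rewrite ler_pM2l // ler_expR; lra.
have PBt : 2 * expR (- (mu / 32)) <= t / 2.
  suff : expR (- (mu / 32)) <= t / 4 by lra.
  (* Squaring brings in [mu * t ^+ 2], and [2304 / 256 = 9] suffices. *)
  rewrite -(@ler_pXn2r _ 2) ?nnegrE ?expR_ge0 ?divr_ge0 //.
  rewrite expr2 -expRD.
  have -> : - (mu / 32) + - (mu / 32) = - (mu / 16) by field.
  rewrite expRN -div1r ler_pdivrMr ?expR_gt0 //.
  have := expR_ge1Dx (mu / 16) => H.
  apply: (@le_trans _ _ ((t / 4) ^+ 2 * (mu / 16))).
    by rewrite expr_div_n; lra.
  by rewrite ler_wpM2l ?sqr_ge0 //; lra.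
have XYB G : 0 <= q G - Y G <= (B G)%:R.
  have /andP[q0 q1] := q01 G.
  rewrite /Y /damped_score -max_modularity_score -/(q G) -/mu.
  set h := _%:R : R; set M := Num.max _ _.
  have h0 : 0 <= h by rewrite /h.
  have hM : h <= M by rewrite le_max lexx.
  have ML : mu / 2 <= M by rewrite le_max lexx orbT.
  have M_gt0 : 0 < M by lra.
  have Y0 : 0 <= h * q G / M by rewrite divr_ge0 ?mulr_ge0 // ltW.
  have YX : h * q G / M <= q G by rewrite ler_pdivrMr // mulrC ler_wpM2l.
  rewrite subr_ge0 YX /=; case: (boolP (B G)) => [_|]; first by rewrite /=; lra.
  rewrite /B -ltNge -/h ltr_distl => /andP[hL _].
  have -> : M = h by apply/max_idPl; lra.
  by rewrite mulrAC divff ?mul1r ?subrr // gt_eqF //; lra.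
apply: le_lt_trans (deviation_transfer P_pmf XYB (le_trans (ltW PB) PBt)) _.
(* With Lipschitz constant [6 / mu], the exponent is [72 * s ^+ 2 / mu - s * t / 2], least at
   [s = mu * t / 288]. *)
have PY : Pr P (fun G => t / 2 <= `|Y G - Ex P Y|) < 2 * expR (- (mu * t ^+ 2 / 1152)).
  have sc : mu * t / 288 * (3 / (mu / 2)) = t / 48 by field; rewrite gt_eqF.
  have := @Gnp_lipschitz_deviation R n p p01 (damped_score (mu / 2)) (3 / (mu / 2)) (mu * t / 288) (t / 2).
  rewrite sc -/P -/mu => H.
  apply: lt_le_trans (H _ _ _) _.
  - by move=> x E xK EK; apply: damped_score_lipschitz; rewrite ?divr_gt0.
  - by rewrite divr_ge0 // mulr_ge0.
  - lra.
  - by rewrite ler_pM2l // ler_expR; lra.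
have e32 : expR (- (mu / 32)) <= expR (- (mu * t ^+ 2 / 1152)).
  rewrite ler_expR lerN2.
  have : mu * t ^+ 2 <= mu by rewrite ler_piMr // expr_le1.
  lra.
(* The two error terms add up to twice the desired form; the lost factor 2 is absorbed by weakening
   1152 to 4608, as [1 + 2304 / 1536 >= 2]. *)
have e2 : 2 * expR (- (mu * t ^+ 2 / 1152)) <= expR (- (4608^-1 * mu * t ^+ 2)).
  have -> : - (4608^-1 * mu * t ^+ 2) = mu * t ^+ 2 / 1536 + - (mu * t ^+ 2 / 1152) by field.
  rewrite expRD ler_wpM2r ?expR_ge0 //.
  have := expR_ge1Dx (mu * t ^+ 2 / 1536); lra.
lra.
Qed.

Theorem theorem7p1 (R : realType) :
  (forall (n m : nat) (t : R),
     (1 <= n)%N -> (m <= 'C(n, 2))%N -> 0 < t ->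
     let q := fun G : graph 'I_n => max_modularity R G in
     let P := @Gnm R n m in
     Pr P (fun G => t <= `|q G - Ex P q|) < 2 * expR (- (t ^+ 2 * m%:R / 2)))
  /\
  (exists2 eta : R, 0 < eta &
     forall (n : nat) (p t : R),
       (1 <= n)%N -> 0 < p < 1 -> 0 <= t ->
       let q := fun G : graph 'I_n => max_modularity R G in
       let P := @Gnp R n p in
       let mu := 'C(n, 2)%:R * p in
       Pr P (fun G => t <= `|q G - Ex P q|) < 2 * expR (- (eta * mu * t ^+ 2))).
Proof.
split=> [n m t _ mn t0|]; first exact: Gnm_concentration.
exists 4608^-1 => [|n p t _ p01 t0]; first by rewrite invr_gt0.
exact: Gnp_concentration.
Qed.
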